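(* Let $\mathcal{E}$ be an even Dirichlet form on $L^2(X,m)$ and let $\mathfrak{D}$ be its Dirichlet space. Assume that every $f\in\mathfrak{D}$ is quasi-continuous and let $p>2$. Then the following are equivalent: (i) for every $q\in[2,p)$ there exists $C>0$ such that $\|f\|_{L^q(X,m)}\le C\|f\|_{\mathfrak{D}}$ for every $f\in\mathfrak{D}$; (ii) for every $q\in[2,p)$ there exists $C>0$ such that $C\,\mathrm{Cap}(A)\ge m(A)^{1/q}$ for every measurable $A\subseteq X$.
   Context: Standing setting: $X$ is a Hausdorff topological space and $m$ is a Borel measure on $X$ with full support, i.e. no nonempty open subset of $X$ has $m$-measure zero. $L^2(X,m)$ is the real $L^2$ space. A Dirichlet form is a functional $\mathcal{E}:L^2(X,m)\to[0,\infty]$ that is convex, lower semicontinuous and densely defined (its effective domain $\mathrm{dom}(\mathcal{E})=\{u:\mathcal{E}(u)<\infty\}$ is dense in $L^2(X,m)$), and such that for all $u,v\in L^2(X,m)$ and $\alpha>0$: (1) $\mathcal{E}(u\wedge v)+\mathcal{E}(u\vee v)\le \mathcal{E}(u)+\mathcal{E}(v)$; (2) $\mathcal{E}\big(v+\tfrac12((u-v+\alpha)_+-(u-v-\alpha)_-)\big)+\mathcal{E}\big(u-\tfrac12((u-v+\alpha)_+-(u-v-\alpha)_-)\big)\le \mathcal{E}(u)+\mathcal{E}(v)$, where $(\cdot)_+$, $(\cdot)_-$ denote positive and negative parts. $\mathcal{E}$ is called even if $\mathcal{E}(0)=0$ and $\mathcal{E}(-u)=\mathcal{E}(u)$ for all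 $u$. Set $\mathcal{E}_1(u)=\|u\|_{L^2(X,m)}^2+\mathcal{E}(u)$. The Dirichlet space is $\mathfrak{D}=\{u\in L^2(X,m):\exists\lambda>0,\ \mathcal{E}_1(\lambda u)<\infty\}$ with the Minkowski norm $\|u\|_{\mathfrak{D}}=\inf\{\lambda>0:\mathcal{E}_1(u/\lambda)\le 1\}$. Capacity: for $A\subseteq X$ let $\mathcal{L}_A=\{u\in L^2(X,m): u\ge 1\ m\text{-a.e. on } U \text{ for some open } U\supseteq A\}$ and define the norm-capacity $\mathrm{Cap}(A)=\inf\{\|u\|_{\mathfrak{D}}: u\in\mathcal{L}_A\}$ (with $\|u\|_{\mathfrak{D}}=\infty$ for $u\notin\mathfrak{D}$, $\inf\emptyset=\infty$). A function $f:X\to\mathbb{R}$ is quasi-continuous if for every $\varepsilon>0$ there is an open set $O\subseteq X$ with $\mathrm{Cap}(O)\le\varepsilon$ such that $f|_{X\setminus O}$ is continuous. An element $f\in L^2(X,m)$ is called quasi-continuous if it has a quasi-continuous representative, and $f$ is then identified with that representative. *)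

(* Defs.v *)
From HB Require Import structures.
From mathcomp Require Import all_boot all_order all_algebra.
From mathcomp Require Import all_classical all_reals all_analysis.
Set Implicit Arguments. Unset Strict Implicit. Unset Printing Implicit Defensive.
Import Order.TTheory GRing.Theory Num.Theory.
Import numFieldNormedType.Exports.
Local Open Scope classical_set_scope.
Local Open Scope ring_scope.

Notation borelT X := (g_sigma_algebraType (@open X)).

Section DirichletDefs.
Context {R : realType} {X : ptopologicalType}.
Variable m : {measure set (borelT X) -> \bar R}.
Variable E : (X -> R) -> \bar R.
Local Open Scope ereal_scope.

Definition L2 (u : X -> R) : Prop :=
  measurable_fun (setT : set (borelT X)) (u : borelT X -> R) /\
  \int[m]_x (`|u x| ^+ 2)%:E < +oo.

Definition L2norm2 (u : X -> R) : \bar R := \int[m]_x (`|u x| ^+ 2)%:E.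

Definition ae_eq (u v : X -> R) : Prop := {ae m, forall x, u x = v x}.

Definition pos_part (t : R) : R := Num.max t 0%R.
Definition neg_part (t : R) : R := Num.max (- t)%R 0%R.

Definition dir_shift (u v : X -> R) (a : R) : X -> R :=
  fun x => (2^-1 * (pos_part (u x - v x + a) - neg_part (u x - v x - a)))%R.

(* E is a Dirichlet form on L^2(X,m).  E is modelled as a functional on
   representatives which is invariant under m-a.e. equality, i.e. a
   functional on L^2(X,m). *)
Definition dirichlet_form : Prop :=
  (forall u v, L2 u -> L2 v -> ae_eq u v -> E u = E v) /\
  (forall u, L2 u -> 0 <= E u) /\
  (forall u v (t : R), L2 u -> L2 v -> (0 <= t <= 1)%R ->
     E (fun x => t * u x + (1 - t) * v x)%R <= t%:E * E u + (1 - t)%:E * E v) /\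
  (forall (u_ : nat -> X -> R) (u : X -> R), (forall n, L2 (u_ n)) -> L2 u ->
     (fun n => L2norm2 (fun x => u_ n x - u x)%R) @ \oo --> 0 ->
     E u <= limn_einf (fun n => E (u_ n))) /\
  (forall u, L2 u -> forall eps : R, (0 < eps)%R ->
     exists v, L2 v /\ E v < +oo /\ L2norm2 (fun x => u x - v x)%R < eps%:E) /\
  (forall u v, L2 u -> L2 v ->
     E (fun x => Num.min (u x) (v x)) + E (fun x => Num.max (u x) (v x))
       <= E u + E v) /\
  (forall u v (a : R), L2 u -> L2 v -> (0 < a)%R ->
     E (fun x => v x + dir_shift u v a x)%R + E (fun x => u x - dir_shift u v a x)%R
       <= E u + E v).

Definition even_form : Prop :=
  E (fun _ => 0%R) = 0 /\ (forall u, L2 u -> E (fun x => - u x)%R = E u).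

Definition E1 (u : X -> R) : \bar R := L2norm2 u + E u.

Definition inD (u : X -> R) : Prop :=
  L2 u /\ exists lam : R, (0 < lam)%R /\ E1 (fun x => lam * u x)%R < +oo.

(* Minkowski norm (= +oo when the set is empty, i.e. u not in D) *)
Definition Dnorm (u : X -> R) : \bar R :=
  ereal_inf [set lam%:E | lam in
    [set lam : R | (0 < lam)%R /\ E1 (fun x => u x / lam)%R <= 1]].

Definition LA (A : set X) : set (X -> R) :=
  [set u | L2 u /\ exists U : set X, open U /\ A `<=` U /\
             {ae m, forall x, U x -> (1 <= u x)%R}].

Definition Cap (A : set X) : \bar R := ereal_inf [set Dnorm u | u in LA A].

Definition quasi_continuous (f : X -> R) : Prop :=
  forall eps : R, (0 < eps)%R -> exists O : set X,
    open O /\ Cap O <= eps%:E /\ {within ~` O, continuous f}.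

Definition qc_elt (f : X -> R) : Prop :=
  exists g : X -> R, ae_eq f g /\ quasi_continuous g.

End DirichletDefs.

(* Main.v *)
Require Import Defs.
From HB Require Import structures.
From mathcomp Require Import all_boot all_order all_algebra.
From mathcomp Require Import all_classical all_reals all_analysis.
From mathcomp Require Import measurable_realfun ring lra.
Set Implicit Arguments. Unset Strict Implicit. Unset Printing Implicit Defensive.
Import Order.TTheory GRing.Theory Num.Theory.
Import numFieldNormedType.Exports.
Local Open Scope classical_set_scope.
Local Open Scope ring_scope.

(** (i) => (ii) is Chebyshev's inequality for admissible functions.
    For (ii) => (i), convexity makes the Minkowski norm subadditive, and
    property (1) applied to [u] and [-u] shows that it decreases under
    [u |-> |u|].  Hence quasi-continuity gives the weak-type bound
    [Cap {|h| > t} <= 3 / t] on the unit ball, up to a null set, and (ii) with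
    an exponent [r] in ]q, p[ turns it into [m {|h| > t} <= (3 C / t)^r].
    A dyadic layer-cake sum controls [|h|^q] where [|h| > 1]; where [|h| <= 1]
    it is dominated by [|h|^2]. *)

(** * Dyadic layer-cake: from a weak-type bound to an integral bound *)

Lemma nneseries_geometric_le (R : realType) (b z : R) : 0 <= b -> 0 < z < 1 ->
  (\sum_(0 <= k <oo) (b * z ^+ k)%:E <= (b / (1 - z))%:E)%E.
Proof.
move=> b0 /andP[z0 z1]; apply: lime_le.
  by apply: is_cvg_nneseries => k _ _; rewrite lee_fin mulr_ge0 ?exprn_ge0// ltW.
apply: nearW => n; rewrite sumEFin lee_fin.
by apply: geometric_le_lim => //; rewrite ger0_norm// ltW.
Qed.

(** For [x <= 1] the square dominates because [q >= 2]. For [x > 1] one term of the sum suffices: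
    the least [n] with [x <= 2 ^ n] is some [k.+1], so [2 ^ k < x] switches on the [k]-th term,
    which is at least the [q]-th power of [x]. *)
Lemma dyadic_majorant (R : realType) (q x : R) : 2 <= q -> 0 <= x ->
  ((x `^ q)%:E <= (x ^+ 2)%:E +
    \sum_(0 <= k <oo) (((2 ^+ k.+1 : R) `^ q) * (2 ^+ k < x)%R%:R)%:E)%E.
Proof.
move=> q2 x0.
have term0 k : (0 <= (((2 ^+ k.+1 : R) `^ q) * (2 ^+ k < x)%R%:R)%:E)%E.
  by rewrite lee_fin mulr_ge0 ?powR_ge0.
have [x1|x1] := leP x 1.
  apply: (@le_trans _ _ (x ^+ 2)%:E); last by rewrite leeDl// nneseries_ge0.
  rewrite lee_fin -powR_mulrn//.
  have [->|xn0] := eqVneq x 0; first by rewrite !powR0// gt_eqF// (lt_le_trans _ q2).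
  by rewrite ger_powR// lt_def xn0 x0.
have exn : exists n, x <= 2 ^+ n.
  have [n xn] : exists n : nat, x <= n%:R.
    by exists (Num.bound x); rewrite ltW// archi_boundP.
  by exists n; rewrite (le_trans xn)// -natrX ler_nat ltnW// ltn_expl.
have [[|k]] := ex_minnP exn; first by rewrite expr0 leNgt x1.
move=> xk mink.
have kx : 2 ^+ k < x by rewrite ltNge; apply/negP => /mink; rewrite ltnn.
rewrite (@nneseriesD1 _ _ k)//= kx mulr1.
apply: (@le_trans _ _ ((2 ^+ k.+1) `^ q)%:E).
  by rewrite lee_fin ge0_ler_powR ?nnegrE ?exprn_ge0// (le_trans _ q2).
by rewrite addeCA leeDl// adde_ge0 ?lee_fin ?sqr_ge0// nneseries_ge0.
Qed.

(** Integrate the dyadic majorant termwise; the weak bound at [t = 2 ^ k] leaves a geometric series,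
    convergent because [q < r]. [S] is chosen before the measure space and [h], so that one constant
    serves the whole unit ball. *)
Lemma weak_type_integral_le (R : realType) (q r K : R) : 2 <= q -> q < r -> 0 < K ->
  exists2 S : R, 0 < S & forall (d : measure_display) (T : measurableType d)
    (mu : {measure set T -> \bar R}) (h : T -> R),
  measurable_fun setT h -> (\int[mu]_x (`|h x| ^+ 2)%:E <= 1)%E ->
  (forall t : R, 0 < t ->
    (mu [set x | t < `|h x|]%R <= ((K / t) `^ r)%:E)%E) ->
  (\int[mu]_x (`|h x| `^ q)%:E <= S%:E)%E.
Proof.
move=> q2 qr K0.
have q0 : 0 < q by rewrite (lt_le_trans _ q2).
pose b := 2 `^ q * K `^ r.
pose z : R := 2 `^ (q - r).
have b0 : 0 < b by rewrite mulr_gt0 ?powR_gt0.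
have z0 : 0 < z by rewrite powR_gt0.
have z1 : z < 1.
  rewrite -(powRr0 2) /z /powR ?gt_eqF// ltr_expR ltr_pM2r ?subr_lt0//.
  by rewrite ln_gt0// ltr1n.
have bz0 : 0 < b / (1 - z) by rewrite divr_gt0// subr_gt0.
(* The 1 bounds the integral of the square of [h], the quotient the geometric series. *)
exists (1 + b / (1 - z)); first by rewrite addr_gt0.
move=> d T mu h mh h2 weak.
have mn : measurable_fun setT (fun x => `|h x|) by exact: measurableT_comp.
have mS (t : R) : measurable [set x | t < `|h x|].
  by rewrite -[X in measurable X]setTI; apply: measurable_fun_ltr.
pose F (k : nat) (x : T) := ((2 ^+ k.+1 : R) `^ q * (2 ^+ k < `|h x|)%R%:R)%:E.
have FE k : F k =
    (fun x => (((2 ^+ k.+1) `^ q)%:E * (\1_[set x | 2 ^+ k < `|h x|] x)%:E)%E).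
  by apply/funext => x; rewrite /F -EFinM indicE mem_setE.
have F0 k x : (0 <= F k x)%E by rewrite lee_fin mulr_ge0 ?powR_ge0.
have mF k : measurable_fun setT (F k).
  rewrite FE; apply: measurable_funeM.
  by apply/measurable_EFinP/measurable_indic.
have m2 : measurable_fun setT (fun x => (`|h x| ^+ 2)%:E).
  by apply/measurable_EFinP/measurable_funX.
apply: (@le_trans _ _ (\int[mu]_x ((`|h x| ^+ 2)%:E + \sum_(0 <= k <oo) F k x)%E)%E).
  apply: ge0_le_integral => //.
  - apply/measurable_EFinP.
    by apply: (measurableT_comp (measurable_powR q)).
  - apply: emeasurable_funD => //.
    by apply: ge0_emeasurable_sum.
  - by move=> x _; exact: dyadic_majorant.
rewrite ge0_integralD//; last 2 first.
- by move=> x _; apply: nneseries_ge0.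
- by apply: ge0_emeasurable_sum.
rewrite EFinD; apply: leeD => //.
rewrite integral_nneseries//.
apply: le_trans (@nneseries_geometric_le _ b z (ltW b0) _); last by rewrite z0.
apply: lee_nneseries => [k _ _|k _]; first exact: integral_ge0.
rewrite FE ge0_integralZl_EFin ?powR_ge0//; last first.
  by apply/measurable_EFinP/measurable_indic.
rewrite integral_indic// setIT.
(* The [k]-th layer contributes at most (2^(k+1))^q (K / 2^k)^r = b z^k. *)
apply: (le_trans (lee_wpmul2l _ (weak _ _))); rewrite ?lee_fin ?powR_ge0 ?exprn_gt0//.
rewrite exprS !powRM ?invr_ge0 ?exprn_ge0// ?(ltW K0)//.
suff -> : z ^+ k = (2 ^+ k) `^ q * (2 ^+ k)^-1 `^ r by rewrite /b; lra.
rewrite -powR_inv1 ?exprn_ge0// -powRrM mulN1r -powRD; last first.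
  by rewrite expf_neq0 ?implybT.
by rewrite -(powR_mulrn _ (ltW z0)) -(powR_mulrn k (ler0n _ 2)) powRAC.
Qed.

(** * Square-integrable functions *)

Section L2_functions.
Context {R : realType} {X : ptopologicalType}.
Context (m : {measure set (borelT X) -> \bar R}).
Implicit Types u v : X -> R.

Lemma measurable_sqr_norm u : measurable_fun setT (u : borelT X -> R) ->
  measurable_fun setT (fun x : borelT X => (`|u x| ^+ 2)%:E).
Proof.
move=> mu; apply/measurable_EFinP/measurable_funX.
exact: measurableT_comp.
Qed.

Lemma L2_measurable u : L2 m u -> measurable_fun setT (u : borelT X -> R).
Proof. by case. Qed.

Lemma L2norm2_ge0 u : (0 <= L2norm2 m u)%E.
Proof. by apply: integral_ge0 => x _; rewrite lee_fin. Qed.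

Lemma L2norm2Z (c : R) u : measurable_fun setT (u : borelT X -> R) ->
  L2norm2 m (fun x => c * u x) = ((c ^+ 2)%:E * L2norm2 m u)%E.
Proof.
move=> mu; rewrite /L2norm2 -ge0_integralZl_EFin ?sqr_ge0//.
- apply: eq_integral => x _.
  by rewrite -EFinM normrM exprMn real_normK ?num_real.
- exact: measurable_sqr_norm.
Qed.

Lemma L2norm2_convex u v (t : R) : L2 m u -> L2 m v -> 0 <= t <= 1 ->
  (L2norm2 m (fun x => (t * u x + (1 - t) * v x)%R)
    <= t%:E * L2norm2 m u + (1 - t)%:E * L2norm2 m v)%E.
Proof.
move=> [mu _] [mv _] /andP[t0 t1].
have t1' : 0 <= 1 - t by rewrite subr_ge0.
have mu2 := measurable_sqr_norm mu.
have mv2 := measurable_sqr_norm mv.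
rewrite /L2norm2 -!ge0_integralZl_EFin//.
rewrite -ge0_integralD//.
- apply: ge0_le_integral => //.
  + apply: measurable_sqr_norm; apply: measurable_funD;
      exact: measurable_funM.
  + by apply: emeasurable_funD; apply: measurable_funeM.
  + move=> x _; rewrite -!EFinM -EFinD lee_fin !real_normK ?num_real//.
    (* The convexity gap of the square is t (1 - t) (u - v)^2. *)
    have := mulr_ge0 (mulr_ge0 t0 t1') (sqr_ge0 (u x - v x)); nra.
- by move=> x _; rewrite -EFinM lee_fin mulr_ge0.
- exact: measurable_funeM.
- by move=> x _; rewrite -EFinM lee_fin mulr_ge0.
- exact: measurable_funeM.
Qed.

Lemma L2Z (c : R) u : L2 m u -> L2 m (fun x => c * u x).
Proof.
move=> [mu u2]; split; first exact: measurable_funM.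
rewrite -/(L2norm2 _ _) L2norm2Z// lte_mul_pinfty ?lee_fin ?sqr_ge0//.
Qed.

Lemma L2_div u (a : R) : L2 m u -> L2 m (fun x => u x / a).
Proof.
move=> Lu.
have -> : (fun x => u x / a) = (fun x => a^-1 * u x) by apply/funext => x; rewrite mulrC.
exact: L2Z.
Qed.

Lemma L2_norm u : L2 m u -> L2 m (fun x => `|u x|).
Proof.
move=> [mu u2]; split; first exact: measurableT_comp.
by under eq_integral do rewrite normr_id.
Qed.

Lemma L2_conv u v (t : R) : L2 m u -> L2 m v -> 0 <= t <= 1 ->
  L2 m (fun x => t * u x + (1 - t) * v x).
Proof.
move=> Lu Lv t01; split.
  by apply: measurable_funD; apply: measurable_funM => //; apply: L2_measurable.
apply: le_lt_trans (L2norm2_convex Lu Lv t01) _.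
have /andP[t0 t1] := t01.
by rewrite lte_add_pinfty// lte_mul_pinfty ?lee_fin ?subr_ge0//; case: Lu Lv => _ ? [].
Qed.

(** Compare the integrals of the indicators. Passing to a quasi-continuous representative preserves
    inclusions only off a null set. *)
Lemma ae_le_measure (A B : set (borelT X)) : measurable A -> measurable B ->
  {ae m, forall x, A x -> B x} -> (m A <= m B)%E.
Proof.
move=> mA mB AB; rewrite -[A]setIT -[B]setIT -!integral_indic//.
apply: ae_ge0_le_integral => //.
- by apply/measurable_EFinP/measurable_indic.
- by apply/measurable_EFinP/measurable_indic.
- apply: filterS AB => x AB _; rewrite lee_fin !indicE ler_nat.
  by case: (pselect (A x)) => Ax; [rewrite !mem_set//; exact: AB|rewrite (memNset Ax)].
Qed.

End L2_functions.

(** * The unit ball of [E1] and the Minkowski norm *)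

Section dirichlet_forms.
Context {R : realType} {X : ptopologicalType}.
Context (m : {measure set (borelT X) -> \bar R}) (E : (X -> R) -> \bar R).
Context (dE : dirichlet_form m E).
Implicit Types u v : X -> R.

Lemma form_ge0 u : L2 m u -> (0 <= E u)%E.
Proof. by case: dE => _ [+ _]; exact. Qed.

Lemma L2norm2_le_E1 u : L2 m u -> (L2norm2 m u <= E1 m E u)%E.
Proof. by move=> Lu; rewrite leeDl// form_ge0. Qed.

(** The minimum and maximum of [u] and [-u] are [-|u|] and [|u|], so by evenness property (1) reads
    2 E(|u|) <= 2 E(u). *)
Lemma E1_norm u : even_form m E -> L2 m u ->
  (E1 m E (fun x => `|u x|%R) <= E1 m E u)%E.
Proof.
move=> [_ evE] Lu; rewrite /E1.
have -> : L2norm2 m (fun x => `|u x|) = L2norm2 m u.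
  by rewrite /L2norm2; under eq_integral do rewrite normr_id.
apply: leeD => //.
have LNu : L2 m (fun x => - u x).
  have -> : (fun x => - u x) = (fun x => -1 * u x) by apply/funext => x; rewrite mulN1r.
  exact: L2Z.
have Lnu := L2_norm Lu.
case: dE => _ [_ [_ [_ [_ [minmax _]]]]].
have := minmax u (fun x => - u x) Lu LNu.
have -> : (fun x => Num.max (u x) (- u x)) = (fun x => `|u x|).
  by apply/funext => x; rewrite maxrN.
have -> : (fun x => Num.min (u x) (- u x)) = (fun x => - `|u x|).
  by apply/funext => x; rewrite minrN.
rewrite !evE//.
(* The factor 2 is removed by adding a strict inequality to itself, which is valid also when [E]
   takes the value +oo. *)
move=> le2; rewrite leNgt; apply/negP => lt; move: le2.
by rewrite leNgt lteD.
Qed.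

(** Both summands of [E1] are convex, hence so is its unit ball; this serves as the triangle
    inequality for the Minkowski norm. *)
Lemma E1_conv_le1 u v (t : R) : L2 m u -> L2 m v -> 0 <= t <= 1 ->
  (E1 m E u <= 1)%E -> (E1 m E v <= 1)%E ->
  (E1 m E (fun x => (t * u x + (1 - t) * v x)%R) <= 1)%E.
Proof.
move=> Lu Lv t01 Eu Ev; have /andP[t0 t1] := t01.
have t1' : 0 <= 1 - t by rewrite subr_ge0.
case: dE => _ [_ [convE _]].
apply: (@le_trans _ _ (t%:E * E1 m E u + (1 - t)%:E * E1 m E v)%E).
  have L2ge0 w : (0 <= L2norm2 m w)%E by exact: L2norm2_ge0.
  have Eu0 := form_ge0 Lu; have Ev0 := form_ge0 Lv.
  rewrite /E1 (ge0_muleDr _ (L2ge0 u) Eu0) (ge0_muleDr _ (L2ge0 v) Ev0) addeACA.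
  by apply: leeD; [exact: L2norm2_convex|exact: convE].
rewrite [leRHS](_ : _ = t%:E * 1 + (1 - t)%:E * 1)%E.
  by rewrite leeD// lee_wpmul2l ?lee_fin.
by rewrite !mule1 -EFinD addrC subrK.
Qed.

Lemma E1_le1_inD u : L2 m u -> (E1 m E u <= 1)%E -> inD m E u.
Proof.
move=> Lu Eu; split=> //; exists 1; split=> //.
by under [X in E1 _ _ X]eq_fun do rewrite mul1r; apply: le_lt_trans Eu (ltry _).
Qed.

Lemma Dnorm_le u (a : R) : 0 < a -> (E1 m E (fun x => (u x / a)%R) <= 1)%E ->
  (Dnorm m E u <= a%:E)%E.
Proof. by move=> a0 Ea; apply: ereal_inf_lbound; exists a. Qed.

Lemma Dnorm_lt_inv u (b : \bar R) : (Dnorm m E u < b)%E -> exists a : R,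
  [/\ 0 < a, (a%:E < b)%E & (E1 m E (fun x => (u x / a)%R) <= 1)%E].
Proof. by move=> /ereal_inf_lt[_ [a [a0 Ea] <-] ab]; exists a; split. Qed.

Lemma Dnorm_lt_inD u (b : \bar R) : L2 m u -> (Dnorm m E u < b)%E -> inD m E u.
Proof.
move=> Lu /Dnorm_lt_inv[a [a0 _ Ea]]; split=> //.
exists a^-1; rewrite invr_gt0; split=> //.
by under [X in E1 _ _ X]eq_fun do rewrite mulrC; apply: le_lt_trans Ea (ltry _).
Qed.

End dirichlet_forms.

(** * Capacity of superlevel sets *)

(** At a point off [O], relative continuity keeps [|g| > t] at nearby points off [O]; nearby points
    inside [O] belong to the union anyway. *)
Lemma open_superlevel_setU {R : realType} {X : topologicalType} (O : set X)
  (g : X -> R) (t : R) : open O -> {within ~` O, continuous g} ->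
  open ([set x | t < `|g x|] `|` O).
Proof.
move=> oO /subspace_continuousP cg; rewrite openE => x [|Ox] /=; last first.
  by apply: filterS (open_nbhs_nbhs (conj oO Ox)) => y; right.
move=> tx; have [Ox|nOx] := pselect (O x).
  by apply: filterS (open_nbhs_nbhs (conj oO Ox)) => y; right.
have /cg/cvg_norm/cvgr_gt/(_ _ tx) := nOx.
rewrite near_withinE => near_gt; apply: filterS near_gt => y gty.
by have [Oy|nOy] := pselect (O y); [right|left; apply: gty].
Qed.

(* If [e] is nearly optimal for the exceptional set [O] off which a
   representative of [h] is continuous, then [|h| / t + |e|] is admissible for
   the open set [{|h| > t}] joined with [O]. *)
Lemma Cap_superlevel {R : realType} {X : ptopologicalType}
  (m : {measure set (borelT X) -> \bar R}) (E : (X -> R) -> \bar R)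
  (h : X -> R) (t : R) :
  dirichlet_form m E -> even_form m E -> L2 m h -> (E1 m E h <= 1)%E ->
  qc_elt m E h -> 0 < t ->
  exists V : set X, [/\ open V, {ae m, forall x, t < `|h x| -> V x} &
    (Cap m E V <= (3 / t)%:E)%E].
Proof.
move=> dE evE Lh Eh [g [hg qg]] t0.
have aeF : Filter (nbhs (almost_everywhere m)) by exact: ae_filter_ringOfSetsType.
have ti0 : 0 < t^-1 by rewrite invr_gt0.
have [W [oO [CapO cg]]] := qg _ ti0.
(* The infimum need not be attained: the slack between [1 / t] and [2 / t] yields a competitor [e]
   and a scale [s < 2 / t] with [e / s] in the unit ball. *)
have : (Cap m E W < (2 / t)%:E)%E.
  by apply: le_lt_trans CapO _; rewrite lte_fin; lra.
move=> /ereal_inf_lt[_ [e [Le [U [oU [OU eU]]]] <-]].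
move=> /Dnorm_lt_inv[s [s0 + Ee]]; rewrite lte_fin => st.
exists ([set x | t < `|g x|] `|` W); split.
- exact: open_superlevel_setU.
- by apply: (filterS _ hg) => x hgx tx; left; rewrite /= -hgx.
(* The scale [l] is below [3 / t], and the weight [c] makes [w / l] a convex combination of [|h|]
   and [|e / s|], both in the unit ball. *)
pose l := t^-1 + s.
have l0 : 0 < l by rewrite addr_gt0.
pose c := t^-1 / l.
have c01 : 0 <= c <= 1.
  by rewrite divr_ge0 ?(ltW ti0) ?(ltW l0)//= ler_pdivrMr// mul1r lerDl ltW.
pose w x := `|h x| / t + `|e x|.
have wE x : w x / l = c * `|h x| + (1 - c) * `|e x / s|.
  rewrite normrM (gtr0_norm (_ : 0 < s^-1)) ?invr_gt0//.
  by rewrite /w /c /l; field; rewrite !gt_eqF ?addr_gt0 ?mulr_gt0.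
have Les := L2_div s Le.
have Lw : L2 m w.
  have -> : w = (fun x => l * (c * `|h x| + (1 - c) * `|e x / s|)).
    by apply/funext => x; rewrite -wE mulrC divfK// gt_eqF.
  by apply/L2Z/L2_conv => //; exact: L2_norm.
apply: (@le_trans _ _ (Dnorm m E w)).
  apply: ereal_inf_lbound; exists w => //; split=> //.
  exists ([set x | t < `|g x|] `|` W); split; first exact: open_superlevel_setU.
  split=> //.
  (* Almost everywhere, [|h| / t] exceeds 1 where [|g| > t], and [|e|] is at least 1 on [W]. *)
  apply: filterS2 hg eU => x hgx eUx [/= tx|/OU/eUx ex].
    rewrite -hgx in tx.
    by rewrite /w -[leLHS]addr0 lerD// ler_pdivlMr// mul1r ltW.
  by rewrite /w -[leLHS]add0r lerD ?(le_trans ex (ler_norm _))// divr_ge0// ltW.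
apply: (@le_trans _ _ l%:E); last by rewrite lee_fin /l; lra.
apply: Dnorm_le => //; under [X in E1 _ _ X]eq_fun do rewrite wE.
apply: E1_conv_le1 => //; try exact: L2_norm.
- by apply: le_trans Eh; exact: E1_norm.
- by apply: le_trans Ee; exact: E1_norm.
Qed.

(** The superlevel set is replaced by the open set [V] covering it almost everywhere, with capacity
    at most [3 / t]; the capacity inequality for [V] is then raised to the power [r]. *)
Lemma capacity_weak_type {R : realType} {X : ptopologicalType}
  (m : {measure set (borelT X) -> \bar R}) (E : (X -> R) -> \bar R) (C r : R) :
  dirichlet_form m E -> even_form m E -> 0 < C -> 0 < r ->
  (forall A : set (borelT X), measurable A ->
    (poweR (m A) r^-1 <= C%:E * Cap m E A)%E) ->
  forall h, L2 m h -> (E1 m E h <= 1)%E -> qc_elt m E h ->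
  forall t : R, 0 < t ->
    (m [set x | (t < `|h x|)%R] <= ((3 * C / t) `^ r)%:E)%E.
Proof.
move=> dE evE C0 r0 capC h Lh Eh qh t t0.
have [V [oV hV CapV]] := Cap_superlevel dE evE Lh Eh qh t0.
have mV : measurable (V : set (borelT X)) by exact: sub_sigma_algebra.
have mh : measurable ([set x | t < `|h x|] : set (borelT X)).
  rewrite -[X in measurable X]setTI; apply: measurable_fun_ltr => //.
  by apply: measurableT_comp => //; apply: L2_measurable Lh.
apply: (le_trans (ae_le_measure mh mV hV)).
have mVr : (poweR (m V) r^-1 <= (3 * C / t)%:E)%E.
  apply: (le_trans (capC V mV)).
  apply: (@le_trans _ _ (C%:E * (3 / t)%:E)%E).
    by rewrite lee_wpmul2l// lee_fin ltW.
  by rewrite -EFinM lee_fin; lra.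
have -> : m V = poweR (poweR (m V) r^-1) r.
  by rewrite -poweRrM mulVf ?gt_eqF// poweRe1.
rewrite -poweR_EFin; apply: gt0_ler_poweR => //; first exact: ltW.
- by rewrite in_itv/= poweR_ge0 leey.
- by rewrite in_itv/= leey andbT lee_fin !mulr_ge0 ?invr_ge0// ltW.
Qed.

(** * Norm estimates and the two implications *)

(** Chebyshev: the [q]-th power of [|f|] dominates the indicator of [A] almost everywhere. *)
Lemma LA_Lnorm_ge {R : realType} {X : ptopologicalType}
  (m : {measure set (borelT X) -> \bar R}) (q : R) (A : set (borelT X)) (f : X -> R) :
  0 < q -> measurable A -> LA m A f ->
  (poweR (m A) q^-1 <= Lnorm m q%:E (EFin \o (f : borelT X -> R)))%E.
Proof.
move=> q0 mA [[mf _] [U [oU [AU fU]]]]; rewrite unlock.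
apply: gt0_ler_poweR; first by rewrite invr_ge0 ltW.
- by rewrite in_itv/= measure_ge0 leey.
- by rewrite in_itv/= leey andbT integral_ge0// => x _; exact: poweR_ge0.
rewrite -[A in leLHS]setIT -integral_indic//.
apply: ae_ge0_le_integral => //.
- by apply/measurable_EFinP/measurable_indic.
- by move=> x _; exact: poweR_ge0.
- apply/measurable_EFinP; apply: (measurableT_comp (measurable_powR q)).
  exact: measurableT_comp.
have aeF : Filter (nbhs (almost_everywhere m)) by exact: ae_filter_ringOfSetsType.
apply: (filterS _ fU) => x fUx _; rewrite lee_fin indicE.
have [Ax|nAx] := pselect (A x); last by rewrite memNset// powR_ge0.
have -> : (x \in A)%:R = 1 `^ q :> R by rewrite mem_set// powR1.
apply: ge0_ler_powR; rewrite ?nnegrE// ?(ltW q0)//.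
exact: le_trans (fUx (AU _ Ax)) (ler_norm _).
Qed.

(** Homogeneity: each scale [a] competing in the Minkowski norm puts [f / a] in the unit ball, so
    the integral of |f|^q is at most a^q S. Taking the [q]-th root and then the infimum over [a]
    gives the bound. *)
Lemma Lnorm_le_Dnorm {R : realType} {X : ptopologicalType}
  (m : {measure set (borelT X) -> \bar R}) (E : (X -> R) -> \bar R) (q S : R) :
  0 < q -> 0 < S ->
  (forall h, L2 m h -> (E1 m E h <= 1)%E ->
    (\int[m]_x (`|h x| `^ q)%:E <= S%:E)%E) ->
  forall f : X -> R, L2 m f ->
    (Lnorm m q%:E (EFin \o (f : borelT X -> R)) <= (S `^ q^-1)%:E * Dnorm m E f)%E.
Proof.
move=> q0 S0 hS f Lf.
have K0 : 0 < S `^ q^-1 by rewrite powR_gt0.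
rewrite -lee_pdivrMl//; apply/ereal_infP => _ [a [a0 Ea] <-].
rewrite lee_pdivrMl// unlock.
have La := L2_div a Lf.
have -> : (\int[m]_x poweR `|(EFin \o f) x|%E q =
           (a `^ q)%:E * \int[m]_x (`|f x / a| `^ q)%:E)%E.
  rewrite -ge0_integralZl_EFin ?powR_ge0//.
  - apply: eq_integral => x _.
    rewrite /= -EFinM -powRM//; last exact: ltW.
    by rewrite normrM (gtr0_norm (_ : 0 < a^-1)) ?invr_gt0// mulrCA divff ?gt_eqF// mulr1.
  - apply/measurable_EFinP; apply: (measurableT_comp (measurable_powR q)).
    by apply: measurableT_comp => //; apply: L2_measurable La.
have -> : ((S `^ q^-1)%:E * a%:E = poweR ((a `^ q)%:E * S%:E) q^-1)%E.
  rewrite -!EFinM poweR_EFin powRM ?powR_ge0 ?(ltW S0)//.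
  by rewrite -powRrM divff ?gt_eqF// powRr1 ?(ltW a0)// mulrC.
have aq0 : (0 <= (a `^ q)%:E)%E by rewrite lee_fin powR_ge0.
have i0 : (0 <= \int[m]_x (`|f x / a| `^ q)%:E)%E.
  by apply: integral_ge0 => x _; rewrite lee_fin powR_ge0.
apply: gt0_ler_poweR; first by rewrite invr_ge0 ltW.
- by rewrite in_itv/= leey andbT mule_ge0.
- by rewrite in_itv/= leey andbT mule_ge0// lee_fin ltW.
- by rewrite lee_wpmul2l// hS.
Qed.

Unset Implicit Arguments.

Theorem mainTheorem5 (R : realType) (X : ptopologicalType)
  (m : {measure set (borelT X) -> \bar R}) (E : (X -> R) -> \bar R) (p : R) :
  hausdorff_space X ->
  (forall U : set X, open U -> U !=set0 -> m U <> 0%E) ->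
  dirichlet_form m E ->
  even_form m E ->
  (forall f, inD m E f -> qc_elt m E f) ->
  2 < p ->
  ((forall q : R, 2 <= q < p -> exists C : R, 0 < C /\
      forall f : X -> R, inD m E f ->
        (Lnorm m q%:E (EFin \o (f : borelT X -> R)) <= C%:E * Dnorm m E f)%E)
   <->
   (forall q : R, 2 <= q < p -> exists C : R, 0 < C /\
      forall A : set (borelT X), measurable A ->
        (poweR (m A) q^-1 <= C%:E * Cap m E A)%E)).
Proof.
move=> _ _ dE evE qcD p2; split=> [emb|cap] q /andP[q2 qp].
- have q0 : 0 < q by rewrite (lt_le_trans _ q2).
  have [|C [C0 embC]] := emb q; first by rewrite q2.
  exists C; split=> // A mA.
  (* With [C] moved to the left, the claim becomes a lower bound for each competitor in the
     capacity. *)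
  rewrite -lee_pdivrMl//; apply/ereal_infP => _ [f LAf <-].
  rewrite lee_pdivrMl//.
  (* An admissible [f] may lie outside the Dirichlet space; its norm is then +oo and the bound is
     trivial. *)
  have [finD|] := ltP (Dnorm m E f) +oo%E.
    apply: le_trans (LA_Lnorm_ge q0 mA LAf) (embC f _).
    by case: LAf => Lf _; exact: Dnorm_lt_inD finD.
  by rewrite leye_eq => /eqP ->; rewrite gt0_muley ?lte_fin// leey.
(* Any exponent strictly between [q] and [p] would do: [r < p] makes (ii) available, and [q < r]
   makes the dyadic series converge. *)
- pose r := (q + p) / 2.
  have qr : q < r by rewrite /r; lra.
  have r0 : 0 < r by lra.
  have [|C [C0 capC]] := cap r; first by rewrite /r; lra.
  have C3 : 0 < 3 * C by rewrite mulr_gt0.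
  have [S S0 hS] := weak_type_integral_le q2 qr C3.
  exists (S `^ q^-1); split; first by rewrite powR_gt0.
  move=> f [Lf _]; apply: (Lnorm_le_Dnorm (S := S)) => //; first by lra.
  move=> h Lh Eh; apply: hS.
  + exact: L2_measurable Lh.
  + exact: le_trans (L2norm2_le_E1 dE Lh) Eh.
  + by apply: (capacity_weak_type dE) => //; apply/qcD/E1_le1_inD.
Qed.
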